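(* Let $\mu$ be a map admitting completion. Then $\mathfrak C\mathfrak C\mu = \mathfrak C\mu$, $\mathfrak S\mathfrak S\mu = \mathfrak S\mu$, $\overline{\mathfrak C}\mu$ is an extension of $\mathfrak C \mathfrak S\mu$, and $$\overline{\mathfrak C}\mu = \overline{\mathfrak C}\,\overline{\mathfrak C}\mu = \overline{\mathfrak C}\mathfrak C \mu = \overline{\mathfrak C}\mathfrak S \mu = \mathfrak C \overline{\mathfrak C}\mu = \mathfrak S \overline{\mathfrak C}\mu = \mathfrak S \mathfrak C\mu.$$ The equality $\overline{\mathfrak C}\mu = \mathfrak C\mathfrak S\mu$ holds if and only if $\mathcal N[\mu] = \widehat{\mathcal N_0[\mu]}$.
   Context: $D_\mu$ denotes the domain of a map $\mu$; all maps here have as domain a set of sets, and their values are arbitrary. Two maps are equal if they have the same domain and the same values; $\nu$ is an extension of $\mu$ if $D_\mu\subset D_\nu$ and $\nu=\mu$ on $D_\mu$. $S[\mu]=\bigcup D_\mu$. For a set of sets $\mathcal K$, $\hat{\mathcal K}=\widehat{\mathcal K}=\{A: A\subset B\text{ for some }B\in\mathcal K\}$. A ring (of sets) is a nonempty set of sets closed under union $A\cup B$ and difference $A\setminus B$. $A\Delta B=(A\setminus B)\cup(B\setminus A)$. For a map $\mu$ with $\varnothing\in D_\mu$, a set $N\in D_\mu$ is $\mu$-null if $\mu(N')=\mu(\varnothing)$ for every $N'\in D_\mu$ with $N'\subset N$; $\mathcal N_\mu$ is the set of all $\mu$-null sets. The map $\mu$ admits completion if $D_\mu$ is a ring and $\mu(B_1)=\mu(B_2)$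 for all $B_1,B_2\in D_\mu$ with $B_1\Delta B_2\in\mathcal N_\mu$. If $\mu$ admits completion, a completion ring for $\mu$ is a ring $\mathcal N$ such that $N\cap B\in\mathcal N$ for all $N\in\mathcal N$, $B\in D_\mu$, and $\mathcal N\cap D_\mu=\mathcal N_\mu$. For sets of sets $\mathcal Q,\mathcal N$, $\Delta(\mathcal Q,\mathcal N)=\{A: A\Delta B\in\mathcal N\text{ for some }B\in\mathcal Q\}$. The $\mathcal N$-completion $\mathfrak C_{\mathcal N}\mu$ is the unique (well-defined) map $\nu$ with $D_\nu=\Delta(D_\mu,\mathcal N)$ and $\nu(A)=\mu(B)$ whenever $A\in D_\nu$, $B\in D_\mu$, $A\Delta B\in\mathcal N$. It is known that $\mathfrak C_{\mathcal N}\mu$ again admits completion. For $\mu$ admitting completion put $\mathcal N_0[\mu]=\{N\subset S[\mu]: N\cap B\in\mathcal N_\mu\text{ for every }B\in D_\mu\}$ and $\mathcal N[\mu]=\{N\subset S[\mu]: N\cap B\in\hat{\mathcal N}_\mu\text{ for every }B\in D_\mu\}$. The sets $\hat{\mathcal N}_\mu$, $\mathcal N_0[\mu]$, $\mathcal N[\mu]$ are completion rings for $\mu$; the corresponding $\mathcal N$-completions of $\mu$ are denoted $\mathfrak C\mu$ (completion), $\mathfrak S\mu$ (saturation) and $\overline{\mathfrak C}\mu$ (essential completion), respectively. Juxtaposition means composition, e.g. $\mathfrak C\mathfrak S\mu=\mathfrak C(\mathfrak S\mu)$. *)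

(* Defs.v *)
From mathcomp Require Import all_boot.
From mathcomp Require Import boolp classical_sets measurable_structure.
Set Implicit Arguments.
Unset Strict Implicit.
Unset Printing Implicit Defensive.
Local Open Scope classical_set_scope.

(* A map whose domain is a set of sets: its sets are subsets of an ambient type
   [T], and [mu A = None] says that [A] is outside the domain.  Leibniz equality
   of such maps (with extensionality) is "same domain and same values". *)
Definition set_map (T V : Type) := set T -> option V.

Section SetMaps.
Context {T V : Type}.
Implicit Types (mu nu : set_map T V) (K Q : set (set T)) (A B N : set T).

Definition dom mu : set (set T) := [set A | mu A <> None].

Definition extension nu mu :=
  dom mu `<=` dom nu /\ forall A, dom mu A -> nu A = mu A.

(* The union of the domain, $S[\mu]$. *)
Definition total_set mu : set T := \bigcup_(A in dom mu) A.

(* $\hat{\mathcal K}$ *)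
Definition hereditary K : set (set T) :=
  [set A | exists2 B, K B & A `<=` B].

(* Differs from [setring] only in asking for nonemptiness instead of [set0]. *)
Definition ring_of_sets K := [/\ K !=set0, setU_closed K & setD_closed K].

(* Meaningful when the empty set belongs to [dom mu]. *)
Definition null_sets mu : set (set T) :=
  [set N | dom mu N /\
    forall N', dom mu N' -> N' `<=` N -> mu N' = mu set0].

Definition admits_completion mu :=
  ring_of_sets (dom mu) /\
  forall B1 B2, dom mu B1 -> dom mu B2 -> null_sets mu (B1 `+` B2) ->
    mu B1 = mu B2.

Definition completion_ring mu K :=
  [/\ ring_of_sets K,
      forall N B, K N -> dom mu B -> K (N `&` B)
    & K `&` dom mu = null_sets mu].

(* $\Delta(\mathcal Q, \mathcal N)$ *)
Definition Delta Q K : set (set T) := [set A | exists2 B, Q B & K (A `+` B)].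

Definition is_Ncompletion K mu nu :=
  dom nu = Delta (dom mu) K /\
  forall A B, dom nu A -> dom mu B -> K (A `+` B) -> nu A = mu B.

(* The value at [A] is [mu B] for a chosen [B] in [dom mu] with
   [K (A `+` B)]; by [NcompletionP] below the choice is irrelevant, and this
   is the unique map satisfying [is_Ncompletion], if [K] is a completion ring. *)
Definition Ncompletion K mu : set_map T V := fun A =>
  if pselect (exists B, dom mu B /\ K (A `+` B)) is left e
  then mu (projT1 (cid e)) else None.

(* $\mathcal N_0[\mu]$ *)
Definition locally_null mu : set (set T) :=
  [set N | N `<=` total_set mu /\
    forall B, dom mu B -> null_sets mu (N `&` B)].

(* $\mathcal N[\mu]$ *)
Definition locally_negligible mu : set (set T) :=
  [set N | N `<=` total_set mu /\
    forall B, dom mu B -> hereditary (null_sets mu) (N `&` B)].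

Definition completion mu := Ncompletion (hereditary (null_sets mu)) mu.
Definition saturation mu := Ncompletion (locally_null mu) mu.
Definition ess_completion mu := Ncompletion (locally_negligible mu) mu.

Lemma Ncompletion_dom K mu : dom (Ncompletion K mu) = Delta (dom mu) K.
Proof.
apply/seteqP; split=> A; rewrite /dom /Ncompletion /=.
  by case: pselect => // -[B [DB NB]] _; exists B.
move=> [B DB NB]; case: pselect => [e|[]]; last by exists B.
by case: (projT2 (cid e)).
Qed.

Lemma ring_of_sets0 K : ring_of_sets K -> K set0.
Proof. by move=> [[A KA] _ KD]; rewrite -(setDv A); exact: KD. Qed.

Lemma ring_of_setsY K A B : ring_of_sets K -> K A -> K B -> K (A `+` B).
Proof. by move=> [_ KU KD] KA KB; apply: KU; exact: KD. Qed.

Lemma NcompletionP K mu : admits_completion mu -> completion_ring mu K ->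
  forall nu, is_Ncompletion K mu nu <-> nu = Ncompletion K mu.
Proof.
move=> [Dring Dnull] [Kring _ KI] nu.
have uniq A B1 B2 : dom mu B1 -> dom mu B2 -> K (A `+` B1) -> K (A `+` B2) ->
    mu B1 = mu B2.
  move=> D1 D2 N1 N2; apply: Dnull => //; rewrite -KI; split; last first.
    exact: (ring_of_setsY Dring).
  have -> : B1 `+` B2 = (A `+` B1) `+` (A `+` B2).
    by rewrite (setYC A) setYA -(setYA B1) setYK setY0.
  exact: (ring_of_setsY Kring).
have val A B : dom mu B -> K (A `+` B) -> Ncompletion K mu A = mu B.
  move=> DB NB; rewrite /Ncompletion; case: pselect => [e|[]]; last by exists B.
  by case: (projT2 (cid e)) => DB' NB'; exact: (uniq A).
split=> [[domE valE]|->]; last first.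
  by split=> [|A B _]; [exact: Ncompletion_dom | exact: val].
apply/funext => A; have [[B DB NB]|nDA] := pselect (Delta (dom mu) K A).
  rewrite (val A B)//; apply: valE => //.
  by rewrite domE; exists B.
have out rho : dom rho = Delta (dom mu) K -> rho A = None.
  by move=> rhoE; apply: contrapT; move: nDA; rewrite -rhoE.
by rewrite !out// Ncompletion_dom.
Qed.

Lemma null_sets_sub mu N A : null_sets mu N -> dom mu A -> A `<=` N ->
  null_sets mu A.
Proof.
move=> [DN null] DA AN; split=> // N' DN' N'A; apply: null => //.
exact: subset_trans AN.
Qed.

Lemma null_sets_ring mu : admits_completion mu -> ring_of_sets (null_sets mu).
Proof.
move=> [Dring Dnull]; have D0 := ring_of_sets0 Dring.
have [_ DU DD] := Dring.
have DI A B : dom mu A -> dom mu B -> dom mu (A `&` B).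
  by move=> DA DB; rewrite -setDD; apply: (DD) => //; exact: DD.
split.
- by exists set0; split=> // N' _; rewrite subset0 => ->.
- move=> A B nA nB; have [DA _] := nA; have [DB _] := nB.
  split; first exact: DU.
  move=> N' DN' N'AB; have DN'A : dom mu (N' `\` A) by exact: DD.
  have nN'A : null_sets mu (N' `\` A).
    by apply: (null_sets_sub nB) => // x [/N'AB[]].
  rewrite -(nN'A.2 _ DN'A)//; apply: Dnull => //.
  have -> : N' `+` (N' `\` A) = N' `&` A.
    apply/seteqP; split=> x.
      by move=> [[N'x /not_andP[//|/contrapT]]|[[]]].
    by move=> [N'x Ax]; left; split=> // -[].
  by apply: (null_sets_sub nA); [exact: DI|exact: subIsetr].
- move=> A B nA [DB _]; apply: (null_sets_sub nA); last exact: subDsetl.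
  by case: nA => DA _; exact: DD.
Qed.

Lemma hereditary_ring K : ring_of_sets K -> ring_of_sets (hereditary K).
Proof.
move=> Kring; have [[A KA] KU _] := Kring; split; first by exists A, A.
- move=> B1 B2 [C1 KC1 BC1] [C2 KC2 BC2]; exists (C1 `|` C2); first exact: KU.
  exact: setUSS.
- by move=> B1 B2 [C KC BC]; exists C => // x [/BC].
Qed.

Lemma hereditary_completion_ring mu : admits_completion mu ->
  completion_ring mu (hereditary (null_sets mu)).
Proof.
move=> hmu; split; first exact/hereditary_ring/null_sets_ring.
- by move=> N B [C nC NC] _; exists C => // x [/NC].
apply/seteqP; split=> N.
  by move=> [[C nC NC] DN]; exact: null_sets_sub NC.
by move=> nN; split; [exists N | case: nN].
Qed.

Lemma local_completion_ring mu K : admits_completion mu ->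
    ring_of_sets K -> K `&` dom mu = null_sets mu ->
    (forall N B, null_sets mu N -> dom mu B -> K (N `&` B)) ->
  completion_ring mu
    [set N | N `<=` total_set mu /\ forall B, dom mu B -> K (N `&` B)].
Proof.
move=> [Dring _] Kring KI KB; have [_ KU KD] := Kring.
have [_ _ DD] := Dring.
have DI A B : dom mu A -> dom mu B -> dom mu (A `&` B).
  by move=> DA DB; rewrite -setDD; apply: (DD) => //; exact: DD.
split; first split.
- exists set0; split=> // B _; rewrite set0I; exact: ring_of_sets0.
- move=> A B [SA hA] [SB hB]; split=> [|C DC]; first by rewrite subUset.
  by rewrite setIUl; apply: KU; [exact: hA|exact: hB].
- move=> A B [SA hA] [SB hB]; split=> [x [/SA]//|C DC].
  have -> : (A `\` B) `&` C = (A `&` C) `\` (B `&` C).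
    apply/seteqP; split=> x; first by move=> [[Ax nBx] Cx]; split=> // -[].
    by move=> [[Ax Cx] nBC]; split=> //; split=> // Bx; apply: nBC.
  by apply: KD; [exact: hA|exact: hB].
- move=> N B [SN hN] DB; split=> [x [/SN]//|C DC].
  by rewrite -setIA; apply: hN; exact: DI.
apply/seteqP; split=> N.
  by move=> [[_ hN] DN]; rewrite -KI; split=> //; rewrite -(setIid N); exact: hN.
move=> nN; have [DN _] := nN; split=> //; split; first by move=> x Nx; exists N.
by move=> B; exact: KB.
Qed.

Lemma locally_null_completion_ring mu : admits_completion mu ->
  completion_ring mu (locally_null mu).
Proof.
move=> hmu; apply: local_completion_ring => //; first exact: null_sets_ring.
  by apply/seteqP; split=> N; [case|move=> nN; split=> //; case: nN].
have [[_ _ DD] _] := hmu.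
move=> N B nN DB; apply: (null_sets_sub nN); last exact: subIsetl.
by case: nN => DN _; rewrite -setDD; apply: (DD) => //; exact: DD.
Qed.

Lemma locally_negligible_completion_ring mu : admits_completion mu ->
  completion_ring mu (locally_negligible mu).
Proof.
move=> hmu; have [Hring _ HI] := hereditary_completion_ring hmu.
by apply: local_completion_ring => // N B nN _; exists N => //; exact: subIsetl.
Qed.

End SetMaps.

(* Main.v *)
Require Import Defs.
From mathcomp Require Import all_boot.
From mathcomp Require Import boolp classical_sets.

(** Write [D] for the domain of [mu], and let [K] be a completion ring for [mu].
    The null sets of [Ncompletion K mu] are exactly the members of [K]
    ([null_sets_Ncompletion]).  Two things follow.

    First, a completion ring [L] for [Ncompletion K mu] contains [K], is itself a
    completion ring for [mu], and completing twice is the same as completing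
    once, with the last ring: [Ncompletion L (Ncompletion K mu)] is
    [Ncompletion L mu] ([Ncompletion_comp]).  Hence each equality in the
    proposition reduces to an equality between two rings of sets: the one by
    which the outer operation completes, computed for [Ncompletion K mu], and
    the one on the other side of the equality, computed for [mu].

    Second, the outer ring depends on [K] alone: it is the hereditary closure of
    [K] for the completion, and it is the family of those sets whose traces on
    the domain of [Ncompletion K mu] lie in [K] (for the saturation) or in the
    hereditary closure of [K] (for the essential completion).  Members of that
    domain have the form [B `+` M] with [D B] and [K M], so it suffices to test
    traces on [D] ([local_sets_Ncompletion]); and on subsets of members of [D]
    the families [locally_null mu] and [null_sets mu] agree, as do their
    hereditary closures.

    Finally [completion (saturation mu)] is the completion of [mu] by the
    hereditary closure of [locally_null mu], which is contained in
    [locally_negligible mu]; this gives the extension.  As a completion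
    determines its ring, namely as its family of null sets, the two maps are
    equal exactly when the two rings are. *)

Section Completions.
Set Implicit Arguments.
Unset Strict Implicit.
Local Open Scope classical_set_scope.
Context {T V : Type}.
Implicit Types (mu : set_map T V) (A B M N : set T) (J K L P Q : set (set T)).

(** * Rings of sets and symmetric differences *)

Lemma ring_of_setsI K A B : ring_of_sets K -> K A -> K B -> K (A `&` B).
Proof. by move=> [_ _ KD] KA KB; rewrite -setDD; apply: (KD) => //; exact: KD. Qed.

Lemma setYKr A B : (A `+` B) `+` B = A.
Proof. by rewrite -setYA setYK setY0. Qed.

Lemma setYKl A B : A `+` (A `+` B) = B.
Proof. by rewrite setYA setYK set0Y. Qed.

Lemma sub_Delta Q K : K set0 -> Q `<=` Delta Q K.
Proof. by move=> K0 A QA; exists A => //; rewrite setYK. Qed.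

(** By distributivity of intersection over symmetric difference, the intersection
    of two sets differs from that of their representatives by three terms, each
    with a factor in [K]. *)
Lemma Delta_ring Q K : ring_of_sets Q -> ring_of_sets K ->
  (forall N B, K N -> Q B -> K (N `&` B)) -> ring_of_sets (Delta Q K).
Proof.
move=> Qring Kring KQ.
have DY A1 A2 : Delta Q K A1 -> Delta Q K A2 -> Delta Q K (A1 `+` A2).
  move=> [B1 QB1 KB1] [B2 QB2 KB2].
  exists (B1 `+` B2); first exact: ring_of_setsY.
  have -> : (A1 `+` A2) `+` (B1 `+` B2) = (A1 `+` B1) `+` (A2 `+` B2).
    by rewrite -!setYA; congr setY; rewrite setYA (setYC A2) -setYA.
  exact: ring_of_setsY.
have DI A1 A2 : Delta Q K A1 -> Delta Q K A2 -> Delta Q K (A1 `&` A2).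
  move=> [B1 QB1 KB1] [B2 QB2 KB2].
  exists (B1 `&` B2); first exact: ring_of_setsI.
  have -> : (A1 `&` A2) `+` (B1 `&` B2) =
      ((A1 `+` B1) `&` (A2 `+` B2)) `+`
      (((A1 `+` B1) `&` B2) `+` ((A2 `+` B2) `&` B1)).
    rewrite -{1}(setYKr A1 B1) -{1}(setYKr A2 B2).
    move: (A1 `+` B1) (A2 `+` B2) => N1 N2.
    by rewrite setIYl !setIYr -!setYA setYK setY0 (setIC B1).
  apply: ring_of_setsY => //; first exact: ring_of_setsI.
  by apply: ring_of_setsY => //; exact: KQ.
split.
- exists set0; apply: sub_Delta; exact: ring_of_sets0.
- by move=> A1 A2 D1 D2; rewrite -setYU; apply: (DY); [exact: DY|exact: DI].
- by move=> A1 A2 D1 D2; rewrite -setYD; apply: (DY) => //; exact: DI.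
Qed.

Lemma Delta_Delta Q K L : ring_of_sets L -> K set0 -> K `<=` L ->
  Delta (Delta Q K) L = Delta Q L.
Proof.
move=> Lring K0 KL; apply/seteqP; split=> A; last first.
  by move=> [B QB LB]; exists B => //; exact: sub_Delta.
move=> [B [C QC KC] LB]; exists C => //.
have -> : A `+` C = (A `+` B) `+` (B `+` C) by rewrite -setYA setYKl.
by apply: ring_of_setsY => //; exact: KL.
Qed.

Lemma sub_hereditary K : K `<=` hereditary K.
Proof. by move=> A KA; exists A. Qed.

Lemma hereditary_id K : (forall A B, K B -> A `<=` B -> K A) ->
  hereditary K = K.
Proof.
move=> Kher; apply/seteqP; split; last exact: sub_hereditary.
by move=> A [B KB AB]; exact: Kher AB.
Qed.

Lemma hereditary_idem K : hereditary (hereditary K) = hereditary K.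
Proof.
apply: hereditary_id => A B [C KC BC] AB; exists C => //.
exact: subset_trans BC.
Qed.

(** * The completion by a ring of sets *)

Lemma NcompletionE mu K A B : admits_completion mu -> completion_ring mu K ->
  dom mu B -> K (A `+` B) -> Ncompletion K mu A = mu B.
Proof.
move=> hmu hK DB KAB; have [_ val] := (NcompletionP hmu hK _).2 erefl.
by apply: val => //; rewrite Ncompletion_dom; exists B.
Qed.

Lemma null_sets_Ncompletion mu K :
  admits_completion mu -> completion_ring mu K ->
  null_sets (Ncompletion K mu) = K.
Proof.
move=> hmu hK; have [Dring _] := hmu; have [Kring KB KI] := hK.
have D0 := ring_of_sets0 Dring; have K0 := ring_of_sets0 Kring.
have nu0 : Ncompletion K mu set0 = mu set0.
  by apply: NcompletionE => //; rewrite setYK.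
apply/seteqP; split=> N.
- move=> [DN nullN]; have [B DB KNB] : Delta (dom mu) K N.
    by rewrite -Ncompletion_dom.
  (* A subset [B'] of [B] differs from its trace on [N] by a member of [K], and
     that trace has the value of the empty set. *)
  suff nB : null_sets mu B.
    rewrite -(setYKr N B); apply: ring_of_setsY => //.
    by move: nB; rewrite -KI => -[].
  split=> // B' DB' B'B.
  have KNB' : K ((B' `&` N) `+` B').
    have -> : (B' `&` N) `+` B' = (N `+` B) `&` B'.
      rewrite setIYl (setIC N); congr setY.
      by rewrite setIC; apply/esym/setIidl.
    exact: KB.
  rewrite -(NcompletionE hmu hK DB' KNB') -nu0.
  apply: nullN; last exact: subIsetr.
  by rewrite Ncompletion_dom; exists B'.
- move=> KN; split.
    by rewrite Ncompletion_dom; exists set0; rewrite ?setY0.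
  move=> N' DN' N'N; rewrite nu0.
  have [B DB KNB] : Delta (dom mu) K N' by rewrite -Ncompletion_dom.
  rewrite (NcompletionE hmu hK DB KNB).
  (* [B `\` N] is also [(N' `+` B) `\` N], because [N'] lies in [N]. *)
  have KmemB : K B.
    have -> : B = ((N' `+` B) `\` N) `|` (N `&` B).
      apply/seteqP; split=> x.
        have [Nx|nNx] := pselect (N x) => Bx; [by right|left].
        by split=> //; right; split=> // /N'N.
      by move=> [[[[/N'N//]|[]//]]|[]].
    have [_ KU KD] := Kring.
    by apply: KU; [exact: KD|exact: KB].
  have [_ nullB] : null_sets mu B by rewrite -KI.
  exact: nullB.
Qed.

Lemma Ncompletion_admits mu K : admits_completion mu -> completion_ring mu K ->
  admits_completion (Ncompletion K mu).
Proof.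
move=> hmu hK; have [Dring _] := hmu; have [Kring KB _] := hK.
split; first by rewrite Ncompletion_dom; exact: Delta_ring.
move=> A1 A2; rewrite null_sets_Ncompletion// Ncompletion_dom.
move=> [B1 DB1 KB1] _ KA.
rewrite (NcompletionE hmu hK DB1 KB1); apply/esym/NcompletionE => //.
have -> : A2 `+` B1 = (A1 `+` A2) `+` (A1 `+` B1).
  by rewrite (setYC A1) -setYA setYKl.
exact: ring_of_setsY.
Qed.

(** The ring [L] contains [K], the null sets of the first completion; so a set
    that differs by a member of [L] from a set of the first completed domain
    differs by a member of [L] from a set of the original one. *)
Lemma Ncompletion_comp mu K L : admits_completion mu ->
  completion_ring mu K -> completion_ring (Ncompletion K mu) L ->
  Ncompletion L (Ncompletion K mu) = Ncompletion L mu.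
Proof.
move=> hmu hK hL; have [Kring _ KI] := hK; have [Lring LB LI] := hL.
have hnu := Ncompletion_admits hmu hK; have K0 := ring_of_sets0 Kring.
have Dsub : dom mu `<=` dom (Ncompletion K mu).
  by rewrite Ncompletion_dom; exact: sub_Delta.
rewrite null_sets_Ncompletion// in LI.
have KL : K `<=` L by rewrite -LI => N [].
have hL' : completion_ring mu L.
  split=> // [N B LN /Dsub|]; first exact: LB.
  by rewrite -KI -LI -setIA (setIidr Dsub).
apply/(NcompletionP hmu hL'); split.
  by rewrite !Ncompletion_dom; exact: Delta_Delta.
move=> A B _ DB LAB; rewrite (NcompletionE hnu hL (Dsub _ DB) LAB).
by apply: NcompletionE => //; rewrite setYK.
Qed.

(** * Sets with traces in a given family *)

(** [locally_null mu] and [locally_negligible mu] are the cases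
    [J := null_sets mu] and [J := hereditary (null_sets mu)], by conversion. *)
Definition local_sets J mu : set (set T) :=
  [set N | N `<=` total_set mu /\ forall B, dom mu B -> J (N `&` B)].

Lemma eq_local_sets J P mu :
  (forall B N, dom mu B -> N `<=` B -> J N <-> P N) ->
  local_sets J mu = local_sets P mu.
Proof.
move=> JP; apply/seteqP.
by split=> N [SN hN]; split=> // B DB; apply/(JP B) => //; exact: hN.
Qed.

Lemma total_set_Ncompletion mu K : K set0 ->
  (forall M, K M -> M `<=` total_set mu) ->
  total_set (Ncompletion K mu) = total_set mu.
Proof.
move=> K0 KS; rewrite /total_set Ncompletion_dom; apply/seteqP; split=> x.
  move=> [A [B DB KAB] Ax]; have [Bx|nBx] := pselect (B x); first by exists B.
  by apply: (KS _ KAB); left.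
by move=> [B DB Bx]; exists B => //; exact: sub_Delta.
Qed.

(** A set of the completed domain is [B `+` M] with [B] in [dom mu] and [M] in
    [K]; its trace on [N] is thus composed of the traces of [B] and [M]. *)
Lemma local_sets_Ncompletion mu K J : ring_of_sets J -> K set0 ->
  (forall M, K M -> M `<=` total_set mu) ->
  (forall N M, local_sets J mu N -> K M -> J (N `&` M)) ->
  local_sets J (Ncompletion K mu) = local_sets J mu.
Proof.
move=> Jring K0 KS JK; rewrite /local_sets total_set_Ncompletion//.
rewrite Ncompletion_dom; apply/seteqP; split=> N [SN hN]; split=> // A.
  by move=> DA; apply: hN; exact: sub_Delta.
move=> [B DB KAB]; rewrite -(setYKr A B) setIYr.
by apply: ring_of_setsY => //; [exact: JK|exact: hN].
Qed.

Lemma local_sets_Ncompletion_hereditary mu K J : K set0 ->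
  (forall M, K M -> M `<=` total_set mu) ->
  ring_of_sets J -> K `<=` J -> hereditary J = J ->
  local_sets J (Ncompletion K mu) = local_sets J mu.
Proof.
move=> K0 KS Jring KJ Jher; apply: local_sets_Ncompletion => // N M _ KM.
by rewrite -Jher; exists M; [exact: KJ|exact: subIsetr].
Qed.

Lemma locally_null_sub_dom mu B N : admits_completion mu ->
  dom mu B -> N `<=` B -> locally_null mu N <-> null_sets mu N.
Proof.
move=> hmu DB NB; split=> [[_ /(_ _ DB)]|nN].
  by rewrite (setIidl NB).
have [_ _ KI] := locally_null_completion_ring hmu.
by move: nN; rewrite -KI => -[].
Qed.

Lemma locally_negligible_sub_dom mu B N :
  dom mu B -> N `<=` B ->
  locally_negligible mu N <-> hereditary (null_sets mu) N.
Proof.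
move=> DB NB; split=> [[_ /(_ _ DB)]|[M nM NM]].
  by rewrite (setIidl NB).
split=> [x Nx|C DC]; first by exists B => //; exact: NB.
by exists M => //; exact: subset_trans NM.
Qed.

Lemma hereditary_locally_null_sub_dom mu B N : admits_completion mu ->
  dom mu B -> N `<=` B ->
  hereditary (locally_null mu) N <-> hereditary (null_sets mu) N.
Proof.
move=> hmu DB NB; split=> -[M hM NM].
  exists (M `&` B); first by case: hM => _; exact.
  by rewrite subsetI.
exists M => //; have [DM _] := hM.
exact/(locally_null_sub_dom hmu DM).
Qed.

Lemma locally_negligible_hereditary mu :
  hereditary (locally_negligible mu) = locally_negligible mu.
Proof.
apply: hereditary_id => A B [SB hB] AB; split; first exact: subset_trans SB.
move=> C DC; have [M nM BM] := hB C DC; exists M => //.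
by apply: subset_trans BM; exact: setSI.
Qed.

Lemma sub_hereditary_locally_null mu :
  hereditary (locally_null mu) `<=` locally_negligible mu.
Proof.
move=> N [M [SM hM] NM]; split; first exact: subset_trans SM.
by move=> B DB; exists (M `&` B); [exact: hM|exact: setSI].
Qed.

(** This family lies between the completion rings [locally_null mu] and
    [locally_negligible mu], so it has the same members in the domain. *)
Lemma hereditary_locally_null_completion_ring mu : admits_completion mu ->
  completion_ring mu (hereditary (locally_null mu)).
Proof.
move=> hmu; have [Sring SB SI] := locally_null_completion_ring hmu.
have [_ _ EI] := locally_negligible_completion_ring hmu.
split; first exact: hereditary_ring.
- by move=> N B [M SM NM] DB; exists (M `&` B); [exact: SB|exact: setSI].
- apply/seteqP; split.
    rewrite -EI; apply: setSI; exact: sub_hereditary_locally_null.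
  rewrite -SI; apply: setSI; exact: sub_hereditary.
Qed.

(** * The rings of an iterated completion *)

Section Iterated.
Variables (mu : set_map T V) (K : set (set T)).
Hypotheses (hmu : admits_completion mu) (hK : completion_ring mu K).

Lemma completion_Ncompletion :
  completion (Ncompletion K mu) = Ncompletion (hereditary K) mu.
Proof.
have := hereditary_completion_ring (Ncompletion_admits hmu hK).
by rewrite /completion null_sets_Ncompletion//; exact: Ncompletion_comp.
Qed.

Lemma saturation_Ncompletion : saturation (Ncompletion K mu) =
  Ncompletion (local_sets K (Ncompletion K mu)) mu.
Proof.
have := locally_null_completion_ring (Ncompletion_admits hmu hK).
rewrite /saturation /locally_null null_sets_Ncompletion//.
exact: Ncompletion_comp.
Qed.

Lemma ess_completion_Ncompletion : ess_completion (Ncompletion K mu) =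
  Ncompletion (local_sets (hereditary K) (Ncompletion K mu)) mu.
Proof.
have := locally_negligible_completion_ring (Ncompletion_admits hmu hK).
rewrite /ess_completion /locally_negligible null_sets_Ncompletion//.
exact: Ncompletion_comp.
Qed.

End Iterated.

Lemma hereditary_null_sub_total mu M :
  hereditary (null_sets mu) M -> M `<=` total_set mu.
Proof. by move=> [N [DN _] MN] x /MN Nx; exists N. Qed.

End Completions.

Theorem proposition4p5 (T V : Type) (mu : set_map T V)
    (hmu : admits_completion mu) :
  completion (completion mu) = completion mu /\
  saturation (saturation mu) = saturation mu /\
  extension (ess_completion mu) (completion (saturation mu)) /\
  ess_completion mu = ess_completion (ess_completion mu) /\
  ess_completion mu = ess_completion (completion mu) /\
  ess_completion mu = ess_completion (saturation mu) /\
  ess_completion mu = completion (ess_completion mu) /\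
  ess_completion mu = saturation (ess_completion mu) /\
  ess_completion mu = saturation (completion mu) /\
  (ess_completion mu = completion (saturation mu) <->
   locally_negligible mu = hereditary (locally_null mu)).
Proof.
have cC := hereditary_completion_ring hmu.
have cS := locally_null_completion_ring hmu.
have cE := locally_negligible_completion_ring hmu.
have [rC _ _] := cC; have [rS _ _] := cS; have [rE _ _] := cE.
have C0 := ring_of_sets0 rC; have S0 := ring_of_sets0 rS.
have E0 := ring_of_sets0 rE.
have localC : local_sets (hereditary (null_sets mu)) (completion mu) =
    locally_negligible mu.
  apply: local_sets_Ncompletion_hereditary => //; last exact: hereditary_idem.
  exact: hereditary_null_sub_total.
have localS : local_sets (locally_null mu) (saturation mu) = locally_null mu.
  have idem : local_sets (locally_null mu) mu = locally_null mu.
    by apply: eq_local_sets => B N; exact: locally_null_sub_dom.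
  rewrite -[RHS]idem; apply: local_sets_Ncompletion => //.
  - by move=> M [].
  - by move=> N M; rewrite idem => SN SM; exact: ring_of_setsI.
have localE : local_sets (locally_negligible mu) (ess_completion mu) =
    locally_negligible mu.
  rewrite [LHS]local_sets_Ncompletion_hereditary//.
  - by apply: eq_local_sets => B N; exact: locally_negligible_sub_dom.
  - by move=> M [].
  - exact: locally_negligible_hereditary.
have localHS : local_sets (hereditary (locally_null mu)) (saturation mu) =
    locally_negligible mu.
  rewrite [LHS]local_sets_Ncompletion_hereditary//.
  - by apply: eq_local_sets => B N; exact: hereditary_locally_null_sub_dom.
  - by move=> M [].
  - exact: hereditary_ring.
  - exact: sub_hereditary.
  - exact: hereditary_idem.
have CSE : completion (saturation mu) =
    Ncompletion (hereditary (locally_null mu)) mu.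
  exact: completion_Ncompletion.
have cHS := hereditary_locally_null_completion_ring hmu.
split; first by rewrite [LHS]completion_Ncompletion// hereditary_idem.
split; first by rewrite [LHS]saturation_Ncompletion// localS.
split.
  rewrite CSE; split=> [|A]; rewrite !Ncompletion_dom.
    move=> A [B DB SAB]; exists B => //.
    exact: sub_hereditary_locally_null.
  move=> [B DB SAB]; rewrite (NcompletionE hmu cHS DB SAB).
  by apply: NcompletionE => //; exact: sub_hereditary_locally_null.
split.
  rewrite [RHS]ess_completion_Ncompletion// locally_negligible_hereditary.
  by rewrite localE.
split.
  by rewrite [RHS]ess_completion_Ncompletion// hereditary_idem localC.
split; first by rewrite [RHS]ess_completion_Ncompletion// localHS.
split.
  by rewrite [RHS]completion_Ncompletion// locally_negligible_hereditary.
split; first by rewrite [RHS]saturation_Ncompletion// localE.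
split; first by rewrite [RHS]saturation_Ncompletion// localC.
rewrite CSE /ess_completion; split=> [eqNu|->//].
rewrite -(null_sets_Ncompletion hmu cE) -(null_sets_Ncompletion hmu cHS).
by rewrite eqNu.
Qed.
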